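(* Let $P$ be a finite poset. If $A$ and $B$ are maximal $*$-antichains of $P$, then $A \wedge B$ is a maximal $*$-antichain of $P$.
   Context: For an antichain $A$ of $P$ let $[A) = \{x \in P \mid x \geq y \text{ for some } y \in A\}$. The set of all antichains of $P$ is ordered by the filter order: $A \leq B$ iff $[A) \supseteq [B)$. With this order it is a lattice in which $A \wedge B$ is the set of minimal elements of $A \cup B$. An antichain $A$ of $P$ is a maximal $r$-antichain iff $|A| = r$ and $A$ is maximal (in the filter order) among the $r$-element antichains of $P$. A maximal $*$-antichain is an antichain that is a maximal $r$-antichain for some $r$. *)

(* Defs.v *)
From mathcomp Require Import all_boot all_order.

Set Implicit Arguments.
Unset Strict Implicit.
Unset Printing Implicit Defensive.

Import Order.TTheory.
Local Open Scope order_scope.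

Definition antichain (d : Order.disp_t) (P : finPOrderType d) (A : {set P}) : bool :=
  [forall x in A, forall y in A, (x != y) ==> (x >< y)].

(* [upfilter A] is the filter usually written [A). *)
Definition upfilter (d : Order.disp_t) (P : finPOrderType d) (A : {set P}) : {set P} :=
  [set x | [exists y in A, y <= x]].

(* The filter order, a partial order on antichains (a preorder on all sets):
   the antichain higher in the order has the smaller filter. *)
Definition filter_le (d : Order.disp_t) (P : finPOrderType d) (A B : {set P}) : bool :=
  upfilter B \subset upfilter A.

Definition minimal_elts (d : Order.disp_t) (P : finPOrderType d) (S : {set P}) : {set P} :=
  [set x in S | [forall y in S, ~~ (y < x)]].

(* On antichains this is the meet (greatest lower bound) for the filter order:
   see [filter_meet_antichain], [filter_le_anti] and [filter_meetP]. *)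
Definition filter_meet (d : Order.disp_t) (P : finPOrderType d) (A B : {set P}) : {set P} :=
  minimal_elts (A :|: B).

Definition max_r_antichain (d : Order.disp_t) (P : finPOrderType d) (r : nat)
    (A : {set P}) : Prop :=
  [/\ antichain A, #|A| = r &
      forall C : {set P},
        antichain C -> #|C| = r -> filter_le A C -> C = A].

Definition max_star_antichain (d : Order.disp_t) (P : finPOrderType d)
    (A : {set P}) : Prop :=
  exists r : nat, max_r_antichain r A.

Section FilterOrder.
Variables (d : Order.disp_t) (P : finPOrderType d).
Implicit Types A B C S : {set P}.

Lemma upfilterP A x :
  reflect (exists2 y, y \in A & y <= x) (x \in upfilter A).
Proof. by rewrite inE; apply: exists_inP. Qed.

Lemma antichainP A :
  reflect {in A &, forall x y, x <= y -> x = y} (antichain A).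
Proof.
apply: (iffP forall_inP) => [acA x y xA yA lexy | acA x xA].
  have /forall_inP/(_ y yA)/implyP := acA x xA.
  by case: eqVneq => // _ /(_ isT); rewrite /Order.comparable lexy.
apply/forall_inP => y yA; apply/implyP; apply: contraNN => /orP[] le.
  by apply/eqP/acA.
by apply/eqP/esym/acA.
Qed.

Lemma minimal_eltsP S x :
  reflect (x \in S /\ forall y, y \in S -> y <= x -> y = x) (x \in minimal_elts S).
Proof.
rewrite inE; apply: (iffP andP) => -[xS minx]; split=> //.
  move=> y yS leyx; apply/eqP; move/forall_inP/(_ y yS): minx.
  by rewrite lt_neqAle leyx andbT negbK.
apply/forall_inP => y yS; rewrite lt_neqAle; apply/negP => /andP[/eqP neq le].
by case: neq; apply: minx.
Qed.

Lemma upfilter_minimal S : upfilter (minimal_elts S) = upfilter S.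
Proof.
apply/setP => x; apply/upfilterP/upfilterP => [[y /minimal_eltsP[yS _] le]|].
  by exists y.
case=> y yS leyx.
pose below z := #|[set t in S | t < z]|.
have Qy : (y \in S) && (y <= x) by rewrite yS.
case: (@arg_minnP _ y (fun z => (z \in S) && (z <= x)) below Qy) => z /andP[zS lezx] minz.
exists z => //; apply/minimal_eltsP; split=> // t tS letz.
apply/eqP; apply/negPn/negP => neq.
have lttz : t < z by rewrite lt_neqAle neq.
have := minz t; rewrite tS (le_trans letz lezx) => /(_ isT).
apply/negP; rewrite -ltnNge; apply: proper_card; apply/properP; split.
  apply/subsetP => u; rewrite !inE => /andP[-> ltut] /=.
  exact: lt_trans ltut lttz.
by exists t; rewrite !inE ?tS ?lttz // ltxx andbF.
Qed.

Lemma filter_le_anti A B :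
  antichain A -> antichain B -> filter_le A B -> filter_le B A -> A = B.
Proof.
have sub C D : antichain C -> filter_le C D -> filter_le D C -> C \subset D.
  move=> /antichainP acC /subsetP leCD /subsetP leDC; apply/subsetP => x xC.
  have /leDC/upfilterP[y yD leyx] : x \in upfilter C by apply/upfilterP; exists x.
  have /leCD/upfilterP[z zC lezy] : y \in upfilter D by apply/upfilterP; exists y.
  have ezx : z = x by apply: acC => //; apply: le_trans leyx.
  suff -> : x = y by [].
  by apply: le_anti; rewrite leyx andbT -ezx.
by move=> acA acB leAB leBA; apply/eqP; rewrite eqEsubset !sub.
Qed.

Lemma filter_meet_antichain A B : antichain (filter_meet A B).
Proof.
apply/antichainP => x y /minimal_eltsP[xS _] /minimal_eltsP[_ miny].
exact: miny.
Qed.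

Lemma filter_meetP A B C :
  filter_le C (filter_meet A B) = filter_le C A && filter_le C B.
Proof.
have upU : upfilter (A :|: B) = upfilter A :|: upfilter B.
  apply/setP => x; rewrite in_setU; apply/upfilterP/orP.
    by case=> y /setUP[] yS le; [left|right]; apply/upfilterP; exists y.
  by case=> /upfilterP[y yS le]; exists y; rewrite // in_setU yS ?orbT.
by rewrite /filter_le upfilter_minimal upU subUset.
Qed.

End FilterOrder.

(* Main.v *)
(** Identify an antichain [A] with its filter [[A)]; the meet becomes the union
    of filters.  The number of minimal elements is supermodular on filters:
    [|A| + |B| <= |A /\ B| + |A \/ B|].  An antichain [A] is a maximal
    *-antichain exactly when every antichain strictly above it is strictly
    smaller; by supermodularity, meeting any antichain [D] with such an [A] then
    strictly increases its cardinality unless [D <= A].  For [D] above [A /\ B],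
    meeting [D] with [A] and then with [B] gives [A /\ B], so [|D| < |A /\ B|]
    unless [D] lies below both [A] and [B], i.e. [D = A /\ B]. *)

Require Import Defs.
From mathcomp Require Import all_boot all_order.

Set Implicit Arguments.
Unset Strict Implicit.
Unset Printing Implicit Defensive.

Import Order.TTheory.

Section Antichains.
Variables (d : Order.disp_t) (P : finPOrderType d).
Implicit Types A B C D : {set P}.

Lemma filter_le_refl A : filter_le A A.
Proof. exact: subxx. Qed.

Lemma filter_le_trans B A C : filter_le A B -> filter_le B C -> filter_le A C.
Proof. by move=> leAB leBC; apply: subset_trans leBC leAB. Qed.

Lemma sub_upfilter A : A \subset upfilter A.
Proof. by apply/subsetP => x xA; apply/upfilterP; exists x. Qed.

Lemma filter_leE A B : filter_le A B = (B \subset upfilter A).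
Proof.
apply/idP/idP; first exact: subset_trans (sub_upfilter B).
move=> /subsetP sBA; apply/subsetP => x /upfilterP[y /sBA/upfilterP[z zA lezy] leyx].
by apply/upfilterP; exists z => //; apply: le_trans leyx.
Qed.

Lemma subset_filter_le A B : B \subset A -> filter_le A B.
Proof. by move=> sBA; rewrite filter_leE (subset_trans sBA) ?sub_upfilter. Qed.

Lemma antichain_subset A B : B \subset A -> antichain A -> antichain B.
Proof.
move=> /subsetP sBA /antichainP acA; apply/antichainP => x y xB yB.
by apply: acA; apply: sBA.
Qed.

Lemma exists_subset_card A n : n <= #|A| -> exists2 B : {set P}, B \subset A & #|B| = n.
Proof.
move=> /card_geqP[s [us sz_s sA]]; exists [set x in s].
  by apply/subsetP => x; rewrite inE => /sA.
by rewrite cardsE (card_uniqP us).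
Qed.

(** Shrinking an antichain raises it in the filter order. So if [D] above [A] has at least [#|A|]
    elements, any subset of [D] of size [#|A|] is still above [A], hence equals [A]; then
    [A \subset D] puts [D] below [A] as well. *)
Lemma max_star_antichainP A :
  max_star_antichain A <->
  antichain A /\ forall D, antichain D -> filter_le A D -> D != A -> #|D| < #|A|.
Proof.
split=> [[r [acA <- maxA]]|[acA maxA]]; last first.
  exists #|A|; split=> // C acC cardC leAC; apply/eqP/negPn/negP => neqCA.
  by have := maxA C acC leAC neqCA; rewrite cardC ltnn.
split=> // D acD leAD; apply: contraNltn => /exists_subset_card[C sCD cardC].
have eCA : C = A.
  apply: maxA cardC _; first exact: antichain_subset acD.
  exact: filter_le_trans leAD (subset_filter_le sCD).
by apply/eqP/filter_le_anti => //; rewrite -eCA subset_filter_le.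
Qed.

(* On antichains, a set of minimal elements of [[A) :&: [B)], though not in
   general all of them: it is the set of those lying in [A :|: B]. *)
Definition upper_part A B : {set P} :=
  (A :&: upfilter B) :|: (B :&: upfilter A).

Lemma upper_partP A B x :
  reflect [/\ x \in A :|: B, x \in upfilter A & x \in upfilter B]
          (x \in upper_part A B).
Proof.
have inA := subsetP (sub_upfilter A) x; have inB := subsetP (sub_upfilter B) x.
apply: (iffP setUP) => [[]/setIP[xS xF]|[/setUP[] xS xA xB]].
- by split; rewrite ?inA // inE xS.
- by split; rewrite ?inB // inE xS orbT.
- by left; apply/setIP.
- by right; apply/setIP.
Qed.

Lemma antichain_upper_part A B :
  antichain A -> antichain B -> antichain (upper_part A B).
Proof.
(* Members of an antichain are minimal in its filter, and [upper_part] lies in both filters, so it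
   does not matter which of [A], [B] contains [y]. *)
have minE C x y : antichain C -> y \in C -> x \in upfilter C -> (x <= y)%O -> x = y.
  move=> /antichainP acC yC /upfilterP[z zC lezx] lexy.
  have ezy : z = y by apply: acC => //; apply: le_trans lexy.
  by apply: le_anti; rewrite lexy -ezy.
move=> acA acB; apply/antichainP => x y /upper_partP[_ xA xB].
by move=> /upper_partP[/setUP[] yS _ _]; apply: minE yS _.
Qed.

(** Supermodularity, with a subset of the join in place of the join. A non-minimal element of
    [A :|: B] lies above an element of the other antichain, hence in [upper_part]; an element of
    [A :&: B] lies in both sets on the right. *)
Lemma leq_card_meet_upper_part A B : antichain A -> antichain B ->
  #|A| + #|B| <= #|filter_meet A B| + #|upper_part A B|.
Proof.
move=> /antichainP acA /antichainP acB.
rewrite -cardsUI -[leqRHS]cardsUI leq_add // subset_leq_card //.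
  apply/subsetP => x xAB; apply/setUP.
  have [xJ|xNJ] := boolP (x \in upper_part A B); [by right | left].
  apply/minimal_eltsP; split=> // y yAB leyx.
  case/setUP: xAB xNJ => xS; case/setUP: yAB => yS; rewrite !inE xS /=.
  - by move=> _; apply: acA.
  - by case/norP => /exists_inP[]; exists y.
  - by case/norP => _ /exists_inP[]; exists y.
  - by move=> _; apply: acB.
apply/subsetP => x /setIP[xA xB]; apply/setIP; split; last first.
  by apply/upper_partP; split; rewrite ?(subsetP (sub_upfilter _)) // inE xA.
apply/minimal_eltsP; split=> [|y /setUP[] yS]; first by rewrite inE xA.
  exact: acA.
exact: acB.
Qed.

(** [upper_part D A] is above [A], and equals [A] only if [A] lies in the filter of [D]. Otherwise
    it is smaller than [A], and supermodularity makes the meet larger than [D]. *)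
Lemma card_meet_max_star A D : max_star_antichain A -> antichain D ->
  #|D| <= #|filter_meet D A| ?= iff filter_le D A.
Proof.
move=> /max_star_antichainP[acA maxA] acD.
have [leDA|nleDA] := boolP (filter_le D A).
  suff -> : filter_meet D A = D by apply/leqif_refl.
  have := filter_le_refl (filter_meet D A); rewrite filter_meetP => /andP[leMD _].
  apply: filter_le_anti => //; first exact: filter_meet_antichain.
  by rewrite filter_meetP filter_le_refl.
suff ltDM : #|D| < #|filter_meet D A|.
  by split; [exact: ltnW | rewrite (ltn_eqF ltDM)].
have /subsetP sJ : upper_part D A \subset upfilter D :&: upfilter A.
  by apply/subsetP => x /upper_partP[_ xD xA]; apply/setIP.
have leAJ : filter_le A (upper_part D A).
  by rewrite filter_leE; apply/subsetP => x /sJ/setIP[].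
have neqJA : upper_part D A != A.
  apply: contraNneq nleDA => eJA; rewrite filter_leE -{1}eJA.
  by apply/subsetP => x /sJ/setIP[].
have ltJA := maxA _ (antichain_upper_part acD acA) leAJ neqJA.
rewrite -(ltn_add2r #|A|).
apply: leq_ltn_trans (leq_card_meet_upper_part acD acA) _.
by rewrite ltn_add2l.
Qed.

End Antichains.

Theorem theorem3p7p3 (d : Order.disp_t) (P : finPOrderType d) (A B : {set P}) :
  max_star_antichain A -> max_star_antichain B ->
  max_star_antichain (filter_meet A B).
Proof.
move=> starA starB; set M := filter_meet A B.
have acM : antichain M := filter_meet_antichain A B.
have /andP[leMA leMB] : filter_le M A && filter_le M B.
  by rewrite -filter_meetP filter_le_refl.
apply/max_star_antichainP; split=> // D acD leMD; apply: contraNltn => card_leMD.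
pose E := filter_meet D A.
have acE : antichain E := filter_meet_antichain D A.
have /andP[leED leEA] : filter_le E D && filter_le E A.
  by rewrite -filter_meetP filter_le_refl.
have /andP[leEBE leEBB] :
    filter_le (filter_meet E B) E && filter_le (filter_meet E B) B.
  by rewrite -filter_meetP filter_le_refl.
have eM : filter_meet E B = M.
  apply: filter_le_anti; rewrite ?filter_meet_antichain // !filter_meetP.
    by rewrite (filter_le_trans leEBE leEA) leEBB.
  by rewrite leMD leMA leMB.
(* The chain [#|D| <= #|E| <= #|M| <= #|D|] collapses, so both equality conditions hold. *)
have := leqif_trans (card_meet_max_star starA acD) (card_meet_max_star starB acE).
rewrite eM => /geq_leqif; rewrite card_leMD => /esym/andP[leDA leEB].
have leDE : filter_le D E by rewrite filter_meetP filter_le_refl.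
apply/eqP/filter_le_anti => //.
by rewrite filter_meetP leDA (filter_le_trans leDE leEB).
Qed.
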